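(* Let $\ell$ be an odd prime. If $A,C\in\mathcal{G}$, then $S(A,C)=0$ unless there exists an injective group homomorphism $\iota:A\hookrightarrow C$ with $\operatorname{coker}(\iota)$ elementary abelian.
   Context: Fix an odd prime $\ell$. $\mathcal{G}$ is the poset of isomorphism classes of finite abelian $\ell$-groups (a group and its isomorphism class are identified, so $=$ in $\mathcal{G}$ means isomorphic), ordered by $A\leq B$ if and only if there is an injective group homomorphism $A\hookrightarrow B$; $A<B$ means $A\leq B$ and $A\not\cong B$. An elementary abelian group here is a group isomorphic to $(\mathbb{Z}/\ell)^n$ for some $n\geq 0$ (the trivial group included). For $A,C\in\mathcal{G}$, $\operatorname{sub}(A,C)$ is the number of subgroups of $C$ that are isomorphic to $A$. An $A$-chain is a finite linearly ordered subset of $\{B\in\mathcal{G}\mid B>A\}$. For an $A$-chain $\mathfrak{C}=\{A_j\}_{j=1}^i$ with $i\ge 1$ and $A<A_1<\cdots<A_i$, set $$\operatorname{sub}(\mathfrak{C}):=(-1)^i\operatorname{sub}(A,A_1)\prod_{j=1}^{i-1}\operatorname{sub}(A_j,A_{j+1}).$$ The function $S:\mathcal{G}\times\mathcal{G}\to\mathbb{Z}$ is defined by $S(A,C)=0$ if $A\nleq C$; $S(A,C)=1$ if $A=C$; and $S(A,C)=\sum_{\mathfrak{C}}\operatorname{sub}(\mathfrak{C})$ if $A<C$, where the sum is over all $A$-chains $\mathfrak{C}$ with $\max\mathfrak{C}=C$. *)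

(* Defs.v *)
From HB Require Import structures.
From mathcomp Require Import all_boot all_order all_algebra.
From mathcomp Require Import all_fingroup all_solvable.
From mathcomp Require Import finmap.

Set Implicit Arguments.
Unset Strict Implicit.
Unset Printing Implicit Defensive.

Import Order.TTheory GRing.Theory.
Local Open Scope group_scope.

Section Embedding.

Variables aT cT : finGroupType.
Implicit Types (G : {set aT}) (H : {set cT}).

(* Boolean form of "there is an injective group homomorphism from G to H",
   modelled on isog; embedsP is the version with {morphism _ >-> _}. *)
Definition embeds G H : bool :=
  [exists f : {ffun aT -> cT},
     [&& morphic G f, dinjectiveb f G & f @: G \subset H]].

Lemma embedsP (G : {group aT}) (H : {group cT}) :
  reflect (exists2 f : {morphism G >-> cT}, 'injm f & f @* G \subset H)
          (embeds G H).
Proof.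
apply: (iffP existsP) => [[f /and3P[fM /dinjectiveP injf sfGH]] | [f injf sfGH]].
  exists (morphm_morphism fM); last by rewrite morphimEdom.
  by apply/injmP=> x y Gx Gy; apply: injf.
have Ef : {in G, [ffun x => f x] =1 f} by move=> x _; rewrite ffunE.
exists [ffun x => f x]; apply/and3P; split.
- by apply/morphicP=> x y Gx Gy; rewrite !ffunE morphM.
- by apply/dinjectiveP=> x y Gx Gy; rewrite !ffunE; apply: (injmP injf).
- by rewrite (eq_in_imset Ef) -morphimEdom.
Qed.

Lemma embeds_isogP (G : {group aT}) (H : {group cT}) :
  reflect (exists2 K : {group cT}, K \subset H & K \isog G) (embeds G H).
Proof.
apply: (iffP (embedsP G H)) => [[f injf sfGH] | [K sKH]].
  by exists (f @* G)%G; rewrite // isog_sym sub_isog.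
by rewrite isog_sym => /isogP[f injf defK]; exists f; rewrite // defK.
Qed.

End Embedding.

Section Classes.

Variable l : nat.

(* By Cayley's theorem every finite group is isomorphic to a subgroup of some
   'S_n, so the groups below represent all isomorphism classes of finite
   abelian l-groups; see ab_class_surj. *)
Definition ab_carrier : Type :=
  {x : {n : nat & {group 'S_n}} | abelian (tagged x) && l.-group (tagged x)}.

HB.instance Definition _ := Choice.on ab_carrier.

Definition carrier_grp (x : ab_carrier) : {group 'S_(tag (val x))} :=
  tagged (val x).

Definition ab_isog (x y : ab_carrier) : bool := carrier_grp x \isog carrier_grp y.

Lemma ab_isog_refl : reflexive ab_isog.
Proof. by move=> x; apply: isog_refl. Qed.

Lemma ab_isog_sym : symmetric ab_isog.
Proof. by move=> x y; apply: isog_sym. Qed.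

Lemma ab_isog_trans : transitive ab_isog.
Proof. by move=> y x z; apply: isog_trans. Qed.

Definition ab_isog_equiv := EquivRel ab_isog ab_isog_refl ab_isog_sym ab_isog_trans.

Definition ab_class : Type := {eq_quot ab_isog_equiv}%qT.

HB.instance Definition _ := Choice.on ab_class.
HB.instance Definition _ := EqQuotient.on ab_class.

Definition deg (A : ab_class) : nat := tag (val (generic_quotient.repr A)).

Definition grp (A : ab_class) : {group 'S_(deg A)} :=
  carrier_grp (generic_quotient.repr A).

Lemma grp_abelian A : abelian (grp A).
Proof. by have /andP[] := valP (generic_quotient.repr A). Qed.

Lemma grp_pgroup A : l.-group (grp A).
Proof. by have /andP[] := valP (generic_quotient.repr A). Qed.

Lemma ab_class_eqE (A B : ab_class) : (A == B) = (grp A \isog grp B).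
Proof.
by rewrite -[A]generic_quotient.reprK -[B]generic_quotient.reprK piE /=
  /ab_isog -/(grp _) !generic_quotient.reprK.
Qed.

Lemma ab_class_surj (gT : finGroupType) (G : {group gT}) :
  abelian G -> l.-group G -> exists A : ab_class, G \isog grp A.
Proof.
move=> cGG lG.
pose r (g : gT) (i : 'I_#|gT|) : 'I_#|gT| := enum_rank (enum_val i * g).
have r_inj g : injective (r g).
  by move=> i j /enum_rank_inj /mulIg /enum_val_inj.
pose f g := perm (@r_inj g).
have fM : {in G &, {morph f : x y / x * y}}.
  move=> x y _ _; apply/permP=> i; rewrite permM !permE /r enum_rankK.
  by rewrite mulgA.
pose fm : {morphism G >-> 'S_#|gT|} := Morphism fM.
have inj_f : 'injm fm.
  apply/injmP=> x y _ _ /permP/(_ (enum_rank 1)).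
  by rewrite !permE /r enum_rankK !mul1g => /enum_rank_inj.
have isoG : G \isog fm @* G by rewrite sub_isog.
have P : abelian (fm @* G) && l.-group (fm @* G).
  by rewrite morphim_abelian // morphim_pgroup.
pose x : ab_carrier := exist _ (existT (fun n => {group 'S_n}) #|gT| (fm @* G)%G) P.
exists (\pi_ab_class x)%qT; apply: isog_trans isoG _.
have : (\pi_ab_class x == \pi_ab_class (generic_quotient.repr (\pi_ab_class x)))%qT.
  by rewrite generic_quotient.reprK.
by rewrite piE.
Qed.

Definition ab_le (A B : ab_class) : bool := embeds (grp A) (grp B).

Lemma ab_le_refl : reflexive ab_le.
Proof. by move=> A; apply/embeds_isogP; exists (grp A); rewrite ?isog_refl. Qed.

Lemma ab_le_anti : antisymmetric ab_le.
Proof.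
move=> A B /andP[/embeds_isogP[K sKB isoKA] /embeds_isogP[H sHA isoHB]].
apply/eqP; rewrite ab_class_eqE isog_sym.
suff defK : grp B :=: K by rewrite defK.
apply/eqP; rewrite eq_sym eqEcard sKB (card_isog isoKA) -(card_isog isoHB).
exact: subset_leq_card.
Qed.

Lemma ab_le_trans : transitive ab_le.
Proof.
move=> B A C /embedsP[f injf sfAB] /embedsP[g injg sgBC]; apply/embeds_isogP.
exists (g @* (f @* grp A))%G; first exact: subset_trans (morphimS g sfAB) sgBC.
rewrite isog_sym; apply: (isog_trans (sub_isog _ injf)) => //.
exact: sub_isog.
Qed.

HB.instance Definition _ := Order.Le_isPOrder.Build (Order.Disp tt tt) ab_class
  ab_le_refl ab_le_anti ab_le_trans.

Lemma ab_leP (A B : ab_class) :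
  reflect (exists2 f : {morphism grp A >-> 'S_(deg B)},
             'injm f & f @* grp A \subset grp B) (A <= B)%O.
Proof. exact: embedsP. Qed.

Definition nsub (A C : ab_class) : nat :=
  #|[set K : {group 'S_(deg C)} | (K \subset grp C) && (K \isog grp A)]|.

Definition is_chain (A : ab_class) (c : {fset ab_class}) : Prop :=
  (forall B, B \in c -> (A < B)%O) /\ {in c &, forall B D, (B >=< D)%O}.

Definition is_max (c : {fset ab_class}) (C : ab_class) : Prop :=
  C \in c /\ (forall B, B \in c -> (B <= C)%O).

(* With s = [:: A; A_1; ...; A_i], the product over j < i has the factors
   nsub A A_1, nsub A_1 A_2, ..., nsub A_(i-1) A_i. *)
Definition chain_sub (A : ab_class) (c : {fset ab_class}) : int :=
  let s := A :: sort <=%O (enum_fset c) in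
  ((-1) ^+ #|` c| * \prod_(j < #|` c|) (nsub (nth A s j) (nth A s j.+1))%:Z)%R.

(* The finite set of classes below C, enumerated through the subgroups of C. *)
Definition below (C : ab_class) : {fset ab_class} :=
  [fset \pi_ab_class x | x in
     pmap (fun K : {group 'S_(deg C)} =>
             insub (existT (fun n => {group 'S_n}) (deg C) K) : option ab_carrier)
          (enum (subgroups (grp C)))]%fset%qT.

Lemma mem_below (B C : ab_class) : (B \in below C) = (B <= C)%O.
Proof.
have piE' (x : ab_carrier) : carrier_grp x \isog grp (\pi_ab_class x)%qT.
  have : (\pi_ab_class x == \pi_ab_class (generic_quotient.repr (\pi_ab_class x)))%qT.
    by rewrite generic_quotient.reprK.
  by rewrite piE.
apply/imfsetP/embeds_isogP => [[x] | [K sKC isoKB]].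
  rewrite /= mem_pmap => /mapP[K]; rewrite mem_enum inE => sKC.
  case: insubP => // y _ Ky [->] ->; exists K => //.
  by have := piE' y; rewrite /carrier_grp Ky.
have P : abelian K && l.-group K.
  by rewrite (abelianS sKC (grp_abelian C)) (pgroupS sKC (grp_pgroup C)).
pose x : ab_carrier := exist _ (existT (fun n => {group 'S_n}) (deg C) K) P.
exists x; last first.
  apply/eqP; rewrite ab_class_eqE isog_sym; apply: isog_trans isoKB.
  by rewrite isog_sym; apply: (piE' x).
rewrite /= mem_pmap; apply/mapP; exists K; first by rewrite mem_enum inE.
by rewrite insubT; congr Some; apply: val_inj.
Qed.

Definition chains (A C : ab_class) : {fset {fset ab_class}} :=
  [fset c in fpowerset (below C) |
    [&& all (fun B => (A < B)%O) (enum_fset c), all2rel >=<%O (enum_fset c),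
        C \in c & all (fun B => (B <= C)%O) (enum_fset c)]]%fset.

Lemma chainsP (A C : ab_class) (c : {fset ab_class}) :
  reflect (is_chain A c /\ is_max c C) (c \in chains A C).
Proof.
rewrite /chains !inE fpowersetE /=.
apply: (iffP and5P) => [[_ /allP cA /allrelP cc Cc /allP cC] | [[cA cc] [Cc cC]]].
  by split; split.
split=> //; [|exact/allP|exact/allrelP|exact/allP].
by apply/fsubsetP=> B Bc; rewrite mem_below cC.
Qed.

Lemma chain_sort_path (A : ab_class) (c : {fset ab_class}) :
  is_chain A c -> path <%O A (sort <=%O (enum_fset c)).
Proof.
move=> [cA cc].
have/(_ (enum_fset c)) sorted_c := sort_sorted_in (leT := <=%O) (P := mem c) cc.
rewrite path_sortedE; last exact: lt_trans.
apply/andP; split; first by apply/allP=> B; rewrite mem_sort => /cA.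
rewrite lt_sorted_uniq_le sort_uniq fset_uniq /=; apply: sorted_c.
exact/allP.
Qed.

Definition S_fun (A C : ab_class) : int :=
  if ~~ (A <= C)%O then 0%R
  else if A == C then 1%R
  else (\sum_(c <- chains A C) chain_sub A c)%R.

End Classes.

(* Main.v *)
(* The function S inverts the matrix sub on isomorphism classes. Another inverse
   is obtained by summing the Moebius function mu(K, C) of the subgroup lattice
   of C over the subgroups K of C isomorphic to A, so
   S(A, C) = \sum_(K <= C, K ~ A) mu(K, C).
   By P. Hall's theorem mu(K, C) vanishes unless K contains the Frattini
   subgroup of C, which for an l-group forces C / K to be elementary abelian. *)

Require Import Defs.
From mathcomp Require Import all_boot all_order all_algebra.
From mathcomp Require Import all_fingroup all_solvable.
From mathcomp Require Import finmap.

Set Implicit Arguments.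
Unset Strict Implicit.
Unset Printing Implicit Defensive.

Import Order.TTheory GRing.Theory.

(** * The Möbius function of a subgroup lattice, with fixed top [G] *)

Section Mobius.

Variables (gT : finGroupType) (G : {group gT}).
Implicit Types K H : {group gT}.
Local Open Scope ring_scope.

(* [n] is recursion fuel: values are meaningful only when [#|G| < n + #|K|],
   see [mob_rec_stable]. *)
Fixpoint mob_rec n K : int :=
  if n is n'.+1 then
    (K == G)%:R
      - \sum_(H : {group gT} | (K \proper H) && (H \subset G)) mob_rec n' H
  else 0.

(** This is mu(K, G); the fuel [#|G|] is enough because [K] has at least one element. *)
Definition mob K : int := mob_rec #|G| K.

Lemma mob_rec_stable n m K :
  (#|G| < n + #|K|)%N -> (#|G| < m + #|K|)%N -> K \subset G ->
  mob_rec n K = mob_rec m K.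
Proof.
elim: n m K => [|n IHn] [|m] K; rewrite ?add0n //.
- by move=> + _ /subset_leq_card; rewrite ltnNge => /negPf->.
- by move=> _ + /subset_leq_card; rewrite ltnNge => /negPf->.
move=> ltn ltm sKG /=; congr (_ - _); apply: eq_bigr => H /andP[ltKH sHG].
have ltc := proper_card ltKH.
by apply: IHn => //; [apply: leq_trans ltn _ | apply: leq_trans ltm _];
  rewrite addSnnS leq_add2l.
Qed.

(** With one extra unit of fuel, harmless by [mob_rec_stable], the recursion unfolds once and its
    inner terms are exactly the [mob H]. *)
Lemma mob_sum K : K \subset G ->
  \sum_(H : {group gT} | (K \subset H) && (H \subset G)) mob H = (K == G)%:R.
Proof.
move=> sKG; rewrite (bigD1 K) ?subxx //=.
have -> : mob K = mob_rec #|G|.+1 K.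
  apply: mob_rec_stable => //; last by rewrite addSn ltnS leq_addr.
  by rewrite -[X in (X < _)%N]addn0 ltn_add2l cardG_gt0.
rewrite /= -[RHS]addr0 -addrA; congr (_ + _); apply/eqP.
rewrite addrC subr_eq0; apply/eqP/eq_bigl => H.
by rewrite properEneq -andbA [RHS]andbC eq_sym [RHS]andbA [RHS]andbC.
Qed.

(* P. Hall: the join of [K] with the Frattini subgroup is a proper subgroup
   of [G] as soon as [K] is, so by induction the sum defining [mob K] is the
   vanishing sum attached to that join. *)
Lemma mob_eq0 K : K \subset G -> ~~ ('Phi(G) \subset K)%g -> mob K = 0.
Proof.
have [n] := ubnP (#|G| - #|K|); elim: n K => // n IHn K leKn sKG nsPK.
have sJG : (K <*> 'Phi(G))%G \subset G by rewrite join_subG sKG Phi_sub.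
have neJ : (K <*> 'Phi(G))%G == G = false.
  apply/eqP => /(congr1 val)/= defG; case/negP: nsPK.
  have defK : K :=: G.
    by rewrite -[LHS]genGid; apply: Phi_nongen; rewrite joingC.
  by rewrite defK Phi_sub.
have := mob_sum sJG; rewrite neJ /= => sumJ0.
have := mob_sum sKG; have -> : K == G = false.
  by apply/eqP=> eKG; rewrite eKG Phi_sub in nsPK.
(* The [H] containing ['Phi(G)] are those above the join and sum to zero; among the others, only the
   term at [K] survives the induction hypothesis. *)
rewrite (bigID (fun H : {group gT} => ('Phi(G) \subset H)%g)) /=.
under eq_bigl => H do rewrite andbAC -join_subG.
rewrite sumJ0 add0r (bigD1 K) ?subxx ?sKG //= big1 ?addr0 // => H.
case/andP=> /andP[/andP[sKH sHG] nsPH] neHK; apply: IHn => //.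
have ltKH : (#|K| < #|H|)%N.
  by apply: proper_card; rewrite properEneq eq_sym sKH andbT.
rewrite -ltnS; apply: leq_trans leKn; rewrite ltnS ltn_sub2l //.
by apply: leq_trans ltKH (subset_leq_card sHG).
Qed.

End Mobius.

(** * Counting subgroups of a given isomorphism type *)

Definition isubs (aT gT : finGroupType) (A : {set aT}) (G : {set gT}) :
    {set {group gT}} :=
  [set K : {group gT} | (K \subset G) && (K \isog A)%g].

Lemma isog_card_isubs_le (aT hT kT : finGroupType) (A : {group aT})
    (H : {group hT}) (H' : {group kT}) :
  (H \isog H')%g -> (#|isubs A H| <= #|isubs A H'|)%N.
Proof.
case/isogP=> f injf defH'.
have injF : {in isubs A H &, injective (fun K : {group hT} => (f @* K)%G)}.
  move=> K L; rewrite !inE => /andP[sKH _] /andP[sLH _] /(congr1 val)/= eKL.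
  by apply/val_inj; apply: (injm_morphim_inj injf).
rewrite -(card_in_imset injF); apply/subset_leq_card/subsetP=> _ /imsetP[K + ->].
rewrite !inE => /andP[sKH isoK]; rewrite -defH' morphimS //=.
by apply: isog_trans isoK; rewrite isog_sym; apply: sub_isog.
Qed.

Lemma isog_card_isubs (aT hT kT : finGroupType) (A : {group aT})
    (H : {group hT}) (H' : {group kT}) :
  (H \isog H')%g -> #|isubs A H| = #|isubs A H'|.
Proof.
by move=> iso; apply/eqP; rewrite eqn_leq !isog_card_isubs_le // isog_sym.
Qed.

(** * Recursion for [S_fun] by the least element of a chain *)

Section Chains.

Variable l : nat.
Implicit Types (A B C : ab_class l) (c : {fset ab_class l}).
Local Open Scope ring_scope.

(** Sorting puts [B] first, so its link to [A] splits off as the first factor, with one sign, and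
    [c] remains as a chain over [B]. *)
Lemma chain_subU A B c :
  is_chain A (B |` c)%fset -> (forall D, D \in c -> (B < D)%O) ->
  chain_sub A (B |` c)%fset = - (nsub A B)%:Z * chain_sub B c.
Proof.
move=> chBc ltB.
have nBc : B \notin c by apply/negP=> /ltB; rewrite ltxx.
have chc : is_chain B c.
  by split=> // D E Dc Ec; apply: chBc.2; rewrite !inE ?Dc ?Ec orbT.
have es : sort <=%O (enum_fset (B |` c)%fset) = B :: sort <=%O (enum_fset c).
  apply: (irr_sorted_eq (leT := <%O)).
  - exact: lt_trans.
  - exact: ltxx.
  - exact: path_sorted (chain_sort_path chBc).
  - exact: chain_sort_path.
  - by move=> D; rewrite mem_sort in_cons mem_sort; apply: in_fset1U.
rewrite /chain_sub es cardfsU1 nBc add1n big_ord_recl exprS /= !mulrA.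
rewrite !mulN1r !mulNr; congr (- _); rewrite -!mulrA mulrCA; congr (_ * (_ * _)).
(* The two products differ only in the default of [nth], which is never reached. *)
have ltj (j : 'I_#|` c|) : (j < size (sort <=%O (enum_fset c)))%N by rewrite size_sort.
by apply: eq_bigr => j _; rewrite add0n !(set_nth_default B A) //= ltnW // ltnS ltj.
Qed.

Lemma mem_chains_min A C c : c \in chains A C ->
  exists2 B, B \in c & forall D, D \in c -> (B <= D)%O.
Proof.
case/chainsP=> chc [Cc _]; have := chain_sort_path chc.
case es : (sort _ _) => [|B s]; first by have := Cc; rewrite -(mem_sort <=%O) es.
rewrite /= lt_path_sortedE => /and3P[_ ltB _]; exists B.
  by rewrite -(mem_sort <=%O) es mem_head.
move=> D; rewrite -(mem_sort <=%O) es in_cons => /predU1P[-> // | Ds].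
by rewrite ltW // (allP ltB).
Qed.

Definition least B c := (B \in c) && all (fun D => (B <= D)%O) (enum_fset c).

Lemma leastP B c :
  reflect (B \in c /\ forall D, D \in c -> (B <= D)%O) (least B c).
Proof. by apply: (iffP andP) => -[Bc /allP]. Qed.

(** Removing [B] matches the chains over [A] with least element [B] and top [C] with the chains over
    [B] with top [C]; [chain_subU] compares their weights. *)
Lemma sum_chains_least A B C : (A < B)%O -> (B <= C)%O ->
  \sum_(c <- chains A C | least B c) chain_sub A c = - (nsub A B)%:Z * S_fun B C.
Proof.
move=> ltAB leBC; rewrite /S_fun leBC /=.
(* If [B = C], removing [B] leaves the empty chain, whose weight 1 agrees with [S_fun C C]. *)
pose t := if B == C then [fset (fset0 : {fset ab_class l})]%fset else chains B C.
have -> : (if B == C then 1 else \sum_(c <- chains B C) chain_sub B c)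
    = \sum_(c <- t) chain_sub B c.
  rewrite /t; case: eqP => // _; rewrite big_seq_fset1 /chain_sub cardfs0 big_ord0.
  by rewrite expr0 mulr1.
have tE c : (c \in t) = if B == C then c == fset0 else c \in chains B C.
  by rewrite /t; case: eqP => // _; apply: in_fset1.
clearbody t.
have tP c : c \in t -> [/\ (forall D, D \in c -> (B < D)%O),
    {in c &, forall D E, (D >=< E)%O}, B = C \/ C \in c
    & forall D, D \in c -> (D <= C)%O].
  rewrite tE; case: eqP => [BC /eqP-> | _]; first by split=> //; left.
  by case/chainsP=> [[? ?] [? ?]]; split=> //; right.
have chU c : c \in t -> (B |` c)%fset \in chains A C.
  case/tP=> ltB cmp BC leC; apply/chainsP; split; split.
  - by move=> D; rewrite !inE => /predU1P[-> // | /ltB]; apply: lt_trans.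
  - move=> D E; rewrite !inE => /predU1P[-> | Dc] /predU1P[-> | Ec].
    + exact: comparablexx.
    + by rewrite lt_comparable ?ltB.
    + by rewrite comparable_sym lt_comparable ?ltB.
    + exact: cmp.
  - by rewrite !inE; case: BC => [-> | ->]; rewrite ?eqxx ?orbT.
  - by move=> D; rewrite !inE => /predU1P[-> // | /leC].
have nB c : c \in t -> B \notin c.
  by case/tP=> ltB _ _ _; apply/negP=> /ltB; rewrite ltxx.
rewrite mulr_sumr -big_filter.
rewrite (perm_big [seq (B |` c)%fset | c <- t]) /=.
  rewrite big_map big_seq [RHS]big_seq; apply: eq_bigr => c ct.
  have [ltB _ _ _] := tP c ct; have /chainsP[chBc _] := chU c ct.
  exact: chain_subU.
apply: uniq_perm.
- by rewrite filter_uniq ?fset_uniq.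
- rewrite map_inj_in_uniq ?fset_uniq // => c d ct dt /(congr1 (fun s => s `\ B)%fset).
  by rewrite !fsetU1K ?nB.
move=> c; rewrite mem_filter; apply/andP/mapP => [[/leastP[Bc minB] cch] | [d dt ->]].
  exists (c `\ B)%fset; last by rewrite fsetD1K.
  have /chainsP[[ltA cmp] [Cc leC]] := cch.
  rewrite tE; case: eqP => [BC | /eqP BC].
    apply/eqP/fsetP=> D; rewrite !inE; apply/andP=> -[/eqP neDB Dc].
    by apply/neDB/le_anti; rewrite {1}BC leC // minB.
  apply/chainsP; split; split.
  - by move=> D; rewrite !inE lt_neqAle eq_sym => /andP[-> /minB].
  - by move=> D E; rewrite !inE => /andP[_ Dc] /andP[_ Ec]; apply: cmp.
  - by rewrite !inE Cc eq_sym BC.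
  - by move=> D; rewrite !inE => /andP[_ /leC].
split; last exact: chU.
apply/leastP; split=> [|D /fset1UP[-> // | Dd]]; first exact: fset1U1.
by rewrite ltW //; case: (tP d dt) => ltB _ _ _; apply: ltB.
Qed.

(** Each chain has exactly one least element, so the sum over chains can be grouped by it. This is
    the sense in which [S_fun] inverts [nsub]. *)
Lemma S_fun_rec A C : (A < C)%O ->
  S_fun A C = - \sum_(B <- below C | (A < B)%O) (nsub A B)%:Z * S_fun B C.
Proof.
move=> ltAC; rewrite {1}/S_fun ltW //= lt_eqF //.
transitivity (\sum_(c <- chains A C)
    \sum_(B <- below C | (A < B)%O && least B c) chain_sub A c).
  rewrite big_seq [RHS]big_seq; apply: eq_bigr => c cch.
  have [B Bc minB] := mem_chains_min cch.
  have /chainsP[[ltA _] [_ leC]] := cch.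
  rewrite -big_filter (perm_big [:: B]) ?big_seq1 //=; apply: uniq_perm => //.
    by rewrite filter_uniq ?fset_uniq.
  move=> D; rewrite mem_filter inE mem_below; apply/idP/eqP => [|->].
    case/andP=> /andP[_ /leastP[Dc minD]] _.
    by apply/le_anti; rewrite minB ?minD.
  by rewrite ltA ?leC // andbT; apply/leastP.
rewrite (exchange_big_dep (fun B => (A < B)%O)) /=; last by move=> ? ? _ /andP[].
rewrite -sumrN big_seq_cond [RHS]big_seq_cond; apply: eq_bigr => B /andP[].
rewrite mem_below => leBC ltAB; rewrite -mulNr -sum_chains_least //.
by apply: eq_bigl => c; rewrite ltAB.
Qed.

(** * [S_fun] as a sum of Möbius values *)

Lemma ab_class_le_isubs A C : (A <= C)%O = (isubs (grp A) (grp C) != set0).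
Proof.
apply/embeds_isogP/set0Pn => [[K sK iK]|[K]]; first by exists K; rewrite inE sK.
by rewrite inE => /andP[]; exists K.
Qed.

(* Inverting the matrix [nsub] on classes amounts to inverting the inclusion
   relation on the subgroups of a representative. *)
Lemma S_fun_mob A C : S_fun A C = \sum_(K in isubs (grp A) (grp C)) mob (grp C) K.
Proof.
have [n] := ubnP (#|grp C| - #|grp A|); elim: n A => // n IHn A leAn.
have [leAC | nleAC] := boolP (A <= C)%O; last first.
  rewrite big_pred0; first by rewrite /S_fun nleAC.
  by move: nleAC; rewrite ab_class_le_isubs negbK => /eqP-> K; rewrite inE.
have [eAC | neAC] := eqVneq A C.
  rewrite eAC (big_pred1 (grp C)) => [|K].
    rewrite /S_fun lexx eqxx /=; have := mob_sum (subxx (grp C)).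
    rewrite eqxx (big_pred1 (grp C)) => [-> //|H] /=.
    by rewrite -val_eqE eqEsubset andbC.
  rewrite inE /=; apply/andP/eqP => [[sKC isoK] | ->]; last by rewrite subxx isog_refl.
  by apply/val_inj/eqP; rewrite eqEcard sKC (card_isog isoK) leqnn.
have ltAC : (A < C)%O by rewrite lt_neqAle neAC.
rewrite S_fun_rec //.
have ltcard B D : (B < D)%O -> (#|grp B| < #|grp D|)%N.
  rewrite lt_neqAle => /andP[neBD /embeds_isogP[K sKD isoK]].
  rewrite -(card_isog isoK) ltn_neqAle subset_leq_card // andbT.
  apply: contraNneq neBD => eK; rewrite ab_class_eqE isog_sym.
  suff <- : K :=: grp D by [].
  by apply/eqP; rewrite eqEcard sKD eK leqnn.
(* By induction [S_fun B C] is a sum over the copies [H] of [B] in [C], and [nsub A B] can be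
   counted inside any such [H]. *)
transitivity (- \sum_(B <- below C | (A < B)%O)
  \sum_(H : {group 'S_(deg C)} | (H \subset grp C) && (H \isog grp B))
     (#|isubs (grp A) H|)%:Z * mob (grp C) H).
  congr (- _); apply: eq_bigr => B ltAB; rewrite IHn; last first.
    rewrite -ltnS; apply: leq_trans leAn; rewrite ltnS ltn_sub2l ?ltcard //.
  rewrite mulr_sumr; apply: eq_big => [H | H]; rewrite inE // => /andP[_ isoH].
  by congr (Posz _ * _); rewrite (isog_card_isubs _ isoH).
rewrite (exchange_big_dep (fun H : {group 'S_(deg C)} => H \subset grp C)) /=; last first.
  by move=> ? ? _ /andP[].
transitivity (- \sum_(H : {group 'S_(deg C)} | H \subset grp C)
   \sum_(K in isubs (grp A) (grp C) | K \proper H) mob (grp C) H).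
  congr (- _); apply: eq_bigr => H sHC.
  (* The subgroup [H] has a single class [B], so the sum over classes collapses to one term. *)
  have [B isoHB] : exists B : ab_class l, (H \isog grp B)%g.
    by apply: ab_class_surj; [apply: abelianS sHC (grp_abelian C)
                             | apply: pgroupS sHC (grp_pgroup C)].
  have leBC : (B <= C)%O by apply/embeds_isogP; exists H.
  have -> : \sum_(D <- below C | (A < D)%O && ((H \subset grp C) && (H \isog grp D)%g))
        #|isubs (grp A) H|%:Z * mob (grp C) H
      = if (A < B)%O then #|isubs (grp A) H|%:Z * mob (grp C) H else 0.
    rewrite big_mkcond (bigD1_seq B) ?mem_below ?fset_uniq //= big1 => [|D neDB].
      by rewrite addr0 sHC isoHB !andbT.
    case: ifP => // /and3P[_ _ isoHD]; case/eqP: neDB; apply/eqP.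
    by rewrite ab_class_eqE -(isog_transl _ isoHD).
  have cardHB := card_isog isoHB.
  (* The coefficient counts the copies of [grp A] properly inside [H]: if [A < B], every copy is
     proper by cardinality; otherwise there is no proper copy. *)
  case: ifP => [ltAB | nltAB].
    rewrite -natz mulr_natl -sumr_const; apply: eq_bigl => K.
    rewrite !inE andbAC; apply/andP/andP => [[sKH isoK] | [/andP[_ ltKH] ?]].
      rewrite properEcard sKH (card_isog isoK) cardHB ltcard // isoK.
      by rewrite (subset_trans sKH).
    by rewrite (proper_sub ltKH).
  rewrite big_pred0 // => K; rewrite inE.
  apply: contraFF nltAB => /andP[/andP[_ isoK] ltKH].
  rewrite lt_neqAle; apply/andP; split.
    apply: contraTneq (proper_card ltKH) => eAB.
    by rewrite (card_isog isoK) eAB cardHB ltnn.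
  rewrite ab_class_le_isubs -card_gt0 -(isog_card_isubs _ isoHB) card_gt0.
  by apply/set0Pn; exists K; rewrite inE proper_sub.
(* For fixed [K], which differs from [grp C], [mob_sum] turns the sum over the [H] strictly above
   [K] into [- mob (grp C) K]. *)
rewrite (exchange_big_dep [in isubs (grp A) (grp C)]) /=; last by move=> ? ? _ /andP[].
rewrite -sumrN; apply: eq_bigr => K AK; have := AK; rewrite inE => /andP[sKC isoK].
have := mob_sum sKC; have -> : K == grp C = false.
  apply: contraTF (ltcard _ _ ltAC) => /eqP <-.
  by rewrite (card_isog isoK) ltnn.
rewrite (bigD1 K) ?subxx //= => /eqP; rewrite addr_eq0 => /eqP ->.
congr (- _); apply: eq_bigl => H.
by rewrite sKC isoK properEneq eq_sym /= [RHS]andbC [RHS]andbA [RHS]andbC.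
Qed.

End Chains.

Theorem corollary3p10 (l : nat) (l_prime : prime l) (l_odd : odd l)
    (A C : ab_class l) :
  (~ exists f : {morphism grp A >-> 'S_(deg C)},
       [/\ 'injm f,
           f @* grp A \subset grp C
         & l.-abelem (grp C / f @* grp A)])%g ->
  S_fun A C = 0%R.
Proof.
move=> noemb; rewrite S_fun_mob big1 // => K; rewrite inE => /andP[sKC isoK].
(* A copy [K] of [A] containing the Frattini subgroup would be the image of an excluded
   embedding. *)
apply: mob_eq0 => //; apply/negP => sPK; apply: noemb.
have := isoK; rewrite isog_sym => /isogP[f injf defK].
exists f; split; rewrite ?defK //.
have nKC : (grp C \subset 'N(K))%g by rewrite (sub_abelian_norm (grp_abelian C)).
have lCK : (l.-group (grp C / K))%g by rewrite quotient_pgroup ?grp_pgroup.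
(* An [l]-group is elementary abelian exactly when its Frattini subgroup is trivial, and that of
   [grp C / K] is the image of ['Phi(grp C)]. *)
rewrite -trivg_Phi // -(quotient_Phi (grp_pgroup C)) // -subG1 quotient_sub1 //.
exact: subset_trans (Phi_sub _) nKC.
Qed.
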